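(* Let $\alpha,\beta,\gamma,\delta\in\mathbb{R}$ with $\alpha+\delta\neq0$ and $\alpha\gamma=0$, and let $G_7$ be the connected, simply connected three-dimensional Lie group with left-invariant Lorentzian metric $g$ whose Lie algebra has a pseudo-orthonormal basis $\{\widetilde e_1,\widetilde e_2,\widetilde e_3\}$, with $\widetilde e_3$ timelike, satisfying $$[\widetilde e_1,\widetilde e_2]=-\alpha\widetilde e_1-\beta\widetilde e_2-\beta\widetilde e_3,\quad [\widetilde e_1,\widetilde e_3]=\alpha\widetilde e_1+\beta\widetilde e_2+\beta\widetilde e_3,\quad [\widetilde e_2,\widetilde e_3]=\gamma\widetilde e_1+\delta\widetilde e_2+\delta\widetilde e_3.$$ Then the symmetrized Ricci tensor $\widetilde\rho^B$ of the Bott connection $\nabla^B$ is not a Codazzi tensor on $(G_7,\nabla^B)$.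
   Context: Basis vectors are identified with left-invariant vector fields on the group $G$; $g(\widetilde e_1,\widetilde e_1)=g(\widetilde e_2,\widetilde e_2)=1$, $g(\widetilde e_3,\widetilde e_3)=-1$, and $g(\widetilde e_i,\widetilde e_j)=0$ for $i\ne j$. Let $\nabla^L$ be the Levi-Civita connection of $g$, $D=\mathrm{span}\{\widetilde e_1,\widetilde e_2\}$, $D^\perp=\mathrm{span}\{\widetilde e_3\}$ (distributions on $G$), with associated projections $\pi_D,\pi_{D^\perp}$ of $TG=D\oplus D^\perp$. The Bott connection $\nabla^B$ is the linear connection given by: $\nabla^B_XY=\pi_D(\nabla^L_XY)$ for $X,Y\in\Gamma^\infty(D)$; $\nabla^B_XY=\pi_D([X,Y])$ for $X\in\Gamma^\infty(D^\perp),Y\in\Gamma^\infty(D)$; $\nabla^B_XY=\pi_{D^\perp}([X,Y])$ for $X\in\Gamma^\infty(D),Y\in\Gamma^\infty(D^\perp)$; $\nabla^B_XY=\pi_{D^\perp}(\nabla^L_XY)$ for $X,Y\in\Gamma^\infty(D^\perp)$. Curvature: $R^B(X,Y)Z=\nabla^B_X\nabla^B_YZ-\nabla^B_Y\nabla^B_XZ-\nabla^B_{[X,Y]}Z$. Ricci tensor: $\rho^B(X,Y)=-g(R^B(X,\widetilde e_1)Y,\widetilde e_1)-g(R^B(X,\widetilde e_2)Y,\widetilde e_2)+g(R^B(X,\widetilde e_3)Y,\widetilde e_3)$. Symmetrized Ricci tensor: $\widetilde\rho^B(X,Y)=\tfrac12(\rho^B(X,Y)+\rho^B(Y,X))$.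 For a linear connection $\nabla$ and a $(0,2)$ tensor field $\omega$: $(\nabla_X\omega)(Y,Z)=X[\omega(Y,Z)]-\omega(\nabla_XY,Z)-\omega(Y,\nabla_XZ)$. The tensor $\omega$ is called a Codazzi tensor on $(G,\nabla)$ if $(\nabla_X\omega)(Y,Z)-(\nabla_Y\omega)(X,Z)=0$ for all vector fields $X,Y,Z$. *)

(* Defs.v *)
From HB Require Import structures.
From mathcomp Require Import all_boot all_order all_algebra.
From mathcomp Require Import all_classical all_reals all_analysis.
From mathcomp Require Import ring.

Set Implicit Arguments.
Unset Strict Implicit.
Unset Printing Implicit Defensive.

Import Order.TTheory GRing.Theory Num.Theory.
Import numFieldNormedType.Exports.

Local Open Scope classical_set_scope.
Local Open Scope ring_scope.

Section Smooth.
Context {R : realType}.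

(* Only meant for [U] open. In finite dimension, a map is C^k on [U] if and only
   if its iterated directional derivatives of order at most [k] exist and are
   continuous on [U]. *)
Fixpoint Cn_on {V W : normedModType R} (k : nat) (U : set V) (f : V -> W) :
    Prop :=
  (forall x, U x -> {for x, continuous f}) /\
  (if k is k'.+1 then
     forall v, (forall x, U x -> derivable f x v) /\ Cn_on k' U ('D_v f)
   else True).

Definition smooth_on {V W : normedModType R} (U : set V) (f : V -> W) : Prop :=
  forall k, Cn_on k U f.

Lemma Cn_onW {V W : normedModType R} k (U : set V) (f : V -> W) :
  Cn_on k.+1 U f -> Cn_on k U f.
Proof.
elim: k f => [|k IH] f [fc fd]; split => // v.
by have [fv /IH fk] := fd v.
Qed.

Lemma Cn_on_ext {V W : normedModType R} k (U : set V) (f h : V -> W) :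
  open U -> (forall x, U x -> f x = h x) -> Cn_on k U f -> Cn_on k U h.
Proof.
move=> oU; elim: k f h => [|k IH] f h fh [fc fd].
  split=> // x Ux.
  have fhx : \forall y \near x, f y = h y.
    by apply: filterS (open_nbhs_nbhs (conj oU Ux)) => y /fh.
  rewrite /prop_for /continuous_at -(fh x Ux).
  by apply: cvg_trans (fc x Ux); exact: near_eq_cvg.
have fhx x : U x -> \forall y \near x, f y = h y.
  by move=> Ux; apply: filterS (open_nbhs_nbhs (conj oU Ux)) => y /fh.
split=> [x Ux|v].
  rewrite /prop_for /continuous_at -(fh x Ux).
  apply: cvg_trans (fc x Ux); apply: near_eq_cvg; exact: fhx.
have [fv fk] := fd v; have [->|v0] := eqVneq v 0.
  split=> [x _|]; first exact: derivable0.
  have [_] := fd 0.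
  have -> : 'D_0 f = 'D_0 h by apply/funext => x; rewrite !derive0.
  by [].
split=> [x Ux|].
  by apply: near_eq_derivable (fv x Ux) => //; exact: fhx.
apply: IH fk => x Ux.
by apply: near_eq_derive => //; exact: fhx.
Qed.

Lemma Cn_on_cst {V W : normedModType R} k (U : set V) (c : W) :
  Cn_on k U (cst c).
Proof.
elim: k c => [|k IH] c; (split=> [x _|]; first exact: cvg_cst) => // v.
split=> [x _|]; first exact: derivable_cst.
have -> : 'D_v (cst c) = cst (0 : W).
  by apply/funext => x; rewrite derive_cst.
exact: IH.
Qed.

Lemma Cn_onD {V W : normedModType R} k (U : set V) (f h : V -> W) :
  open U -> Cn_on k U f -> Cn_on k U h -> Cn_on k U (f + h).
Proof.
move=> oU; elim: k f h => [|k IH] f h [fc fd] [hc hd];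
  (split=> [x Ux|]; first exact: (cvgD (fc x Ux) (hc x Ux))) => // v.
have [[fv fk] [hv hk]] := (fd v, hd v).
split=> [x Ux|]; first exact: derivableD (fv x Ux) (hv x Ux).
apply: (@Cn_on_ext _ _ _ _ ('D_v f + 'D_v h)) => //; last exact: IH.
by move=> x Ux; rewrite deriveD //; [exact: fv|exact: hv].
Qed.

Lemma Cn_onM {V : normedModType R} k (U : set V) (f h : V -> R) :
  open U -> Cn_on k U f -> Cn_on k U h -> Cn_on k U (f * h).
Proof.
move=> oU; elim: k f h => [|k IH] f h fk hk.
  have [[fc _] [hc _]] := (fk, hk).
  by split=> // x Ux; exact: (cvgM (fc x Ux) (hc x Ux)).
have [[fc fd] [hc hd]] := (fk, hk).
split=> [x Ux|v]; first exact: (cvgM (fc x Ux) (hc x Ux)).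
have [[fv fvk] [hv hvk]] := (fd v, hd v).
split=> [x Ux|]; first exact: derivableM (fv x Ux) (hv x Ux).
apply: (@Cn_on_ext _ _ _ _ (f * 'D_v h + h * 'D_v f)) => //.
  by move=> x Ux; rewrite deriveM //; [exact: fv|exact: hv].
by apply: Cn_onD => //; apply: IH => //; exact: Cn_onW.
Qed.

End Smooth.

Section SimplyConnected.
Context (R : realType) (T : topologicalType).

Definition path_between (x y : T) (p : R -> T) : Prop :=
  [/\ {within `[0, 1], continuous p}, p 0 = x & p 1 = y].

Definition simply_connected : Prop :=
  (forall x y : T, exists p, path_between x y p) /\
  (forall (x : T) (p : R -> T), path_between x x p ->
     exists H : R * R -> T,
       [/\ {within `[0, 1] `*` `[0, 1], continuous H},
           forall t, t \in `[0, 1] -> H (0, t) = p t,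
           forall t, t \in `[0, 1] -> H (1, t) = x &
           forall s, s \in `[0, 1] -> H (s, 0) = x /\ H (s, 1) = x]).

End SimplyConnected.

(* [chart_map] and [chart_inv] are total functions; their values outside of
   [chart_dom] and [chart_cod] are irrelevant. *)
Record chart (R : realType) (n : nat) (T : topologicalType) := Chart {
  chart_dom : set T;
  chart_map :> T -> 'rV[R]_n;
  chart_inv : 'rV[R]_n -> T;
  chart_dom_open : open chart_dom;
  chart_cod_open : open (chart_map @` chart_dom);
  chart_mapK : forall p, chart_dom p -> chart_inv (chart_map p) = p;
  chart_map_continuous : {within chart_dom, continuous chart_map};
  chart_inv_continuous : {within chart_map @` chart_dom, continuous chart_inv}
}.

Arguments chart_dom_open {R n T} c.
Arguments chart_cod_open {R n T} c.

Definition chart_cod {R n T} (c : @chart R n T) := c @` chart_dom c.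

HB.mixin Record isManifold (R : realType) (n : nat) M & Topological M := {
  atlas : set (@chart R n M);
  manifold_hausdorff : hausdorff_space M;
  manifold_second_countable : @second_countable M;
  atlas_cover : forall p : M, exists2 c, atlas c & chart_dom c p;
  atlas_compatible : forall c d, atlas c -> atlas d ->
    smooth_on (c @` (chart_dom c `&` chart_dom d)) (d \o chart_inv c)
}.

#[short(type="manifoldType")]
HB.structure Definition Manifold (R : realType) (n : nat) :=
  {M of isManifold R n M & Topological M}.

HB.mixin Record isLieGroup (R : realType) (n : nat) G & Group G
    & Manifold R n G := {
  mulg_continuous : continuous (fun z : G * G => (z.1 * z.2)%g);
  invg_continuous : continuous (fun x : G => x^-1%g);
  mulg_smooth : forall c1 c2 d : chart R n G, atlas c1 -> atlas c2 -> atlas d ->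
    smooth_on
      [set z : 'rV[R]_n * 'rV[R]_n |
        [/\ chart_cod c1 z.1, chart_cod c2 z.2 &
            chart_dom d (chart_inv c1 z.1 * chart_inv c2 z.2)%g]]
      (fun z => d (chart_inv c1 z.1 * chart_inv c2 z.2)%g);
  invg_smooth : forall c d : chart R n G, atlas c -> atlas d ->
    smooth_on [set v | chart_cod c v /\ chart_dom d ((chart_inv c v)^-1)%g]
      (fun v => d ((chart_inv c v)^-1)%g)
}.

#[short(type="lieGroupType")]
HB.structure Definition LieGroup (R : realType) (n : nat) :=
  {G of isLieGroup R n G & Group G & Manifold R n G}.

Section SmoothFunctions.
Context {R : realType} {n : nat} (M : manifoldType R n).

Definition smooth : {pred M -> R} :=
  mem [set f : M -> R | forall c : chart R n M, atlas c ->
    smooth_on (chart_cod c) (f \o chart_inv c)].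

Fact smooth_subring_closed : subring_closed smooth.
Proof.
have smoothD f h : f \in smooth -> h \in smooth -> f + h \in smooth.
  rewrite !inE => /= fs hs c ac k.
  exact: (Cn_onD (chart_cod_open c) (fs c ac k) (hs c ac k)).
have smoothM f h : f \in smooth -> h \in smooth -> f * h \in smooth.
  rewrite !inE => /= fs hs c ac k.
  exact: (Cn_onM (chart_cod_open c) (fs c ac k) (hs c ac k)).
have smoothC (a : R) : cst a \in smooth.
  by rewrite inE => /= c ac k; exact: Cn_on_cst.
split=> [|f h fs hs|]; [exact: smoothC| |exact: smoothM].
apply: smoothD => //.
have -> : - h = cst (-1) * h by apply/funext => x; rewrite /= !fctE mulN1r.
exact: smoothM.
Qed.

HB.instance Definition _ :=
  GRing.isSubringClosed.Build (M -> R) smooth smooth_subring_closed.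

Record smoothFun := SmoothFun {
  smoothFun_val :> M -> R;
  smoothFunP : smoothFun_val \in smooth
}.

HB.instance Definition _ := [isSub for smoothFun_val].
HB.instance Definition _ := [Choice of smoothFun by <:].
HB.instance Definition _ :=
  GRing.SubChoice_isSubComPzRing.Build _ _ smoothFun (subringClosedP _).

Lemma smoothFun_eqP (f h : smoothFun) : f = h <-> f =1 h.
Proof. by split=> [->//|fh]; apply/val_inj/funext. Qed.

Fact smooth_cst_subproof (a : R) : cst a \in smooth.
Proof. by rewrite inE => /= c ac k; exact: Cn_on_cst. Qed.

Definition smooth_cst (a : R) : smoothFun := SmoothFun (smooth_cst_subproof a).

(* Smooth vector fields on a manifold are identified with the derivations of the
   algebra of smooth functions. *)
Definition derivation : {pred smoothFun -> smoothFun^o} :=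
  mem [set X : smoothFun -> smoothFun^o |
    (forall a f h, X (smooth_cst a * f + h) = smooth_cst a * X f + X h) /\
    (forall f h, X (f * h) = f * X h + X f * h)].

Fact derivation_submod_closed : submod_closed derivation.
Proof.
split=> [|u X Y]; rewrite !inE /=.
  by split=> *; rewrite ?mulr0 ?mul0r addr0.
move=> [Xl Xm] [Yl Ym]; split=> [a f h|f h].
  rewrite -[LHS]/(u * X (smooth_cst a * f + h) + Y (smooth_cst a * f + h)).
  rewrite -[RHS]/(smooth_cst a * (u * X f + Y f) + (u * X h + Y h)).
  by rewrite Xl Yl !mulrDr (mulrCA u) addrACA.
rewrite -[LHS]/(u * X (f * h) + Y (f * h)).
rewrite -[RHS]/(f * (u * X h + Y h) + (u * X f + Y f) * h).
by rewrite Xm Ym !(mulrDr, mulrDl) (mulrCA u) (mulrA u (X f)) addrACA.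
Qed.

HB.instance Definition _ :=
  GRing.isSubmodClosed.Build smoothFun (smoothFun -> smoothFun^o) derivation
    derivation_submod_closed.

Record vfield := VField {
  vfield_val :> smoothFun -> smoothFun^o;
  vfieldP : vfield_val \in derivation
}.

HB.instance Definition _ := [isSub for vfield_val].
HB.instance Definition _ := [Choice of vfield by <:].
HB.instance Definition _ := [SubChoice_isSubLmodule of vfield by <:].

End SmoothFunctions.

Arguments smooth {R n} M.
Arguments smooth_cst {R n} M.
Arguments derivation {R n} M.

Section VectorFields.
Context {R : realType} {n : nat} {M : manifoldType R n}.
Local Notation Cinf := (smoothFun M).
Local Notation Vect := (vfield M).

Lemma vfieldZD (U : Vect) a (f h : Cinf) :
  U (smooth_cst M a * f + h) = smooth_cst M a * U f + U h.
Proof. by have := vfieldP U; rewrite inE => -[Ul _]; exact: Ul. Qed.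

Lemma vfieldM (U : Vect) (f h : Cinf) : U (f * h) = f * U h + U f * h.
Proof. by have := vfieldP U; rewrite inE => -[_ Um]; exact: Um. Qed.

Lemma vfieldD (U : Vect) (f h : Cinf) : U (f + h) = U f + U h.
Proof.
have := vfieldZD U 1 f h.
have -> : smooth_cst M 1 = 1 by exact/smoothFun_eqP.
by rewrite !mul1r.
Qed.

Fact lie_bracket_subproof (U V : Vect) :
  (fun f => U (V f) - V (U f)) \in derivation M.
Proof.
rewrite inE /=; split=> [a f h|f h].
  by rewrite !vfieldZD opprD mulrBr addrACA.
rewrite [V (f * h)]vfieldM [U (f * h)]vfieldM !vfieldD !vfieldM.
move: (U f) (U h) (V f) (V h) (U (V f)) (U (V h)) (V (U f)) (V (U h)).
move: f h => f h; rewrite /GRing.regular => a b c d u v w z; ring.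
Qed.

Definition lie_bracket (U V : Vect) : Vect := VField (lie_bracket_subproof U V).

Definition tensor02 (w : Vect -> Vect -> Cinf) : Prop :=
  (forall f U U' V, w (f *: U + U') V = f * w U V + w U' V) /\
  (forall f U V V', w U (f *: V + V') = f * w U V + w U V').

(* At every point [p], the form induced by [g] on the tangent space has a
   pseudo-orthonormal basis with exactly one timelike vector; tangent vectors at
   [p] are the values at [p] of vector fields. *)
Definition lorentzian_metric (g : Vect -> Vect -> Cinf) : Prop :=
  [/\ tensor02 g,
      forall U V, g U V = g V U &
      forall p : M, exists E : 'I_n -> Vect,
        (forall i j, g (E i) (E j) p =
           if i == j then (if i.+1 == n then -1 else 1) else 0) /\
        (forall V : Vect, exists c : 'I_n -> R, forall f : Cinf,
           (V f : Cinf) p = \sum_i c i * (E i f : Cinf) p)].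

Definition linear_connection (nabla : Vect -> Vect -> Vect) : Prop :=
  [/\ forall f U U' V, nabla (f *: U + U') V = f *: nabla U V + nabla U' V,
      forall U V V', nabla U (V + V') = nabla U V + nabla U V' &
      forall (U : Vect) f V,
        nabla U (f *: V) = (U f : Cinf) *: V + f *: nabla U V].

Definition levi_civita (g : Vect -> Vect -> Cinf)
    (nabla : Vect -> Vect -> Vect) : Prop :=
  [/\ linear_connection nabla,
      forall U V, nabla U V - nabla V U = lie_bracket U V &
      forall (U V W : Vect), U (g V W) = g (nabla U V) W + g V (nabla U W)].

(* Smooth sections of the distribution spanned by the vector fields [s]. *)
Definition span_sections (s : seq Vect) : set Vect :=
  [set U | exists c : 'I_(size s) -> Cinf, U = \sum_i c i *: s`_i].

Definition projections (D D' : set Vect) (pi pi' : Vect -> Vect) : Prop :=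
  forall U, [/\ D (pi U), D' (pi' U) & U = pi U + pi' U].

Definition bott_connection (D D' : set Vect) (pi pi' : Vect -> Vect)
    (nablaL nabla : Vect -> Vect -> Vect) : Prop :=
  [/\ linear_connection nabla,
      forall U V, D U -> D V -> nabla U V = pi (nablaL U V),
      forall U V, D' U -> D V -> nabla U V = pi (lie_bracket U V),
      forall U V, D U -> D' V -> nabla U V = pi' (lie_bracket U V) &
      forall U V, D' U -> D' V -> nabla U V = pi' (nablaL U V)].

Definition curvature (nabla : Vect -> Vect -> Vect) (U V W : Vect) : Vect :=
  nabla U (nabla V W) - nabla V (nabla U W) - nabla (lie_bracket U V) W.

Definition ricci (g : Vect -> Vect -> Cinf) (nabla : Vect -> Vect -> Vect)
    (e1 e2 e3 U V : Vect) : Cinf :=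
  - g (curvature nabla U e1 V) e1 - g (curvature nabla U e2 V) e2
  + g (curvature nabla U e3 V) e3.

Definition symmetrized (w : Vect -> Vect -> Cinf) (U V : Vect) : Cinf :=
  smooth_cst M 2^-1 * (w U V + w V U).

Definition covariant_derivative (nabla : Vect -> Vect -> Vect) (w : Vect -> Vect -> Cinf)
    (U V W : Vect) : Cinf :=
  (U (w V W) : Cinf) - w (nabla U V) W - w V (nabla U W).

Definition codazzi (nabla : Vect -> Vect -> Vect) (w : Vect -> Vect -> Cinf) : Prop :=
  forall U V W, covariant_derivative nabla w U V W
                - covariant_derivative nabla w V U W = 0.

End VectorFields.

Section LeftInvariance.
Context {R : realType} {n : nat} {G : lieGroupType R n}.

(* [U'] is the push-forward of [U] along the left translation by [a]; [h] is the
   pull-back of [f] along this translation. *)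
Definition translation_related (a : G) (U U' : vfield G) : Prop :=
  forall f h : smoothFun G, (forall x, h x = f (a * x)%g) ->
  forall x, (U h : smoothFun G) x = (U' f : smoothFun G) (a * x)%g.

Definition left_invariant (U : vfield G) : Prop :=
  forall a, translation_related a U U.

Definition left_invariant_metric (g : vfield G -> vfield G -> smoothFun G) :
    Prop :=
  forall a U U' V V', translation_related a U U' -> translation_related a V V' ->
  forall x, g U V x = g U' V' (a * x)%g.

(* The Lie algebra of [G] is the real vector space of its left-invariant vector
   fields, with the bracket [lie_bracket]. *)
Definition lie_algebra_basis (e : seq (vfield G)) : Prop :=
  (forall U, U \in e -> left_invariant U) /\
  (forall U, left_invariant U ->
     exists! c : 'rV[R]_(size e), U = \sum_i smooth_cst G (c 0 i) *: e`_i).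

End LeftInvariance.

(* Main.v *)
Require Import Defs.
From HB Require Import structures.
From mathcomp Require Import all_boot all_order all_algebra.
From mathcomp Require Import all_classical all_reals all_analysis.
From mathcomp Require Import ring lra.

Import Order.TTheory GRing.Theory Num.Theory.
Import numFieldNormedType.Exports.

Local Open Scope classical_set_scope.
Local Open Scope ring_scope.

(** All the objects in play have constant components in the frame
[e1, e2, e3]: the structure constants of the Lie algebra determine the
Levi-Civita connection by the Koszul formula, hence the Bott connection, its
curvature, its Ricci tensor and the covariant derivative of the symmetrized
Ricci tensor, since derivatives of constants vanish. So the Codazzi equations
on frame vectors are polynomial equations in [alpha, beta, gamma, delta].

This passage from vector fields to real numbers rests on three facts. The Ricci tensor is bilinear over smooth functions ([ricci_tensor02]), so that
expanding in the frame is legitimate; the components of curvature and covariant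
derivatives are computed for an arbitrary frame in which the bracket, the
connection and the forms have constant coefficients ([frame_curvature],
[frame_covariant_derivative]); and the Bott connection is expressed through the
structure constants of a pseudo-orthonormal frame ([bott_frame]). The vector
fields [e1, e2, e3] generate all vector fields over the smooth functions because
the two projections split every field into sections of the two spans, and the
coefficients are then read off with the metric ([projections_frame]).

Given [alpha * gamma = 0], the Codazzi equations at (e1, e2, e1), (e1, e3, e1)
and (e2, e3, e3) amount to
  beta^2 delta = 0,
  4 alpha^3 - alpha^2 delta - 2 alpha delta^2 - 4 beta^2 delta = 0,
  delta (alpha delta + 3 beta gamma + 2 delta^2) = 0.
If [delta = 0] the second one gives [alpha = 0]. Otherwise [beta = 0], the third
one gives [alpha = - 2 delta], and the second one becomes [- 32 delta^3 = 0].
Either way [alpha + delta = 0], which is excluded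
([g7_codazzi_alpha_delta]). *)

Set Implicit Arguments.
Unset Strict Implicit.

(** * Constants and vector fields as operators *)

Section Constants.
Context {R : realType} {n : nat} {M : manifoldType R n}.

Fact smooth_cst_is_zmod_morphism : zmod_morphism (smooth_cst M).
Proof. by move=> a b; apply/smoothFun_eqP. Qed.

Fact smooth_cst_is_monoid_morphism : monoid_morphism (smooth_cst M).
Proof. by split=> [|a b]; apply/smoothFun_eqP. Qed.

HB.instance Definition _ :=
  GRing.isZmodMorphism.Build R (smoothFun M) (smooth_cst M)
    smooth_cst_is_zmod_morphism.
HB.instance Definition _ :=
  GRing.isMonoidMorphism.Build R (smoothFun M) (smooth_cst M)
    smooth_cst_is_monoid_morphism.

(** The point is what makes the ring of smooth functions nonzero. *)
Lemma smooth_cst_inj (p : M) : injective (smooth_cst M).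
Proof. by move=> a b /smoothFun_eqP /(_ p). Qed.

Lemma vfield0 (U : vfield M) : U 0 = 0.
Proof. by apply: (addIr (U 0)); rewrite -vfieldD !add0r. Qed.

Lemma vfield_cst (U : vfield M) a : U (smooth_cst M a) = 0.
Proof.
have U1 : U 1 = 0.
  by apply: (addIr (U 1)); rewrite add0r -{3}[1]mulr1 vfieldM mul1r mulr1.
by have := vfieldZD U a 1 0; rewrite vfield0 U1 mulr1 mulr0 !addr0.
Qed.

(** Together with [vfieldE], this reduces an identity between combinations of
vector fields to an identity in a commutative ring, where [ring] applies. *)
Lemma vfield_ext (U V : vfield M) :
  (forall h, U h = V h :> smoothFun M) -> U = V.
Proof. by move=> UV; apply/val_inj/funext. Qed.

Lemma vfield_addE (U V : vfield M) h :
  ((U + V) h : smoothFun M) = (U h : smoothFun M) + (V h : smoothFun M).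
Proof. by []. Qed.

Lemma vfield_oppE (U : vfield M) h :
  ((- U) h : smoothFun M) = - (U h : smoothFun M).
Proof. by []. Qed.

Lemma vfield_scaleE f (U : vfield M) h :
  ((f *: U) h : smoothFun M) = f * (U h : smoothFun M).
Proof. by []. Qed.

Definition vfieldE := (vfield_addE, vfield_oppE, vfield_scaleE).

End Constants.

(** * Tensoriality *)

Section Tensors.
Context {R : realType} {n : nat} {M : manifoldType R n}.
Local Notation Cinf := (smoothFun M).
Local Notation Vect := (vfield M).

Section Forms.
Context {w : Vect -> Vect -> Cinf} (w_tensor : tensor02 w).

Lemma tensor02_0l V : w 0 V = 0.
Proof.
apply: (addIr (w 0 V)); rewrite add0r -[X in X + _]mul1r -(w_tensor.1 1).
by rewrite scaler0 addr0.
Qed.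

Lemma tensor02_0r U : w U 0 = 0.
Proof.
apply: (addIr (w U 0)); rewrite add0r -[X in X + _]mul1r -(w_tensor.2 1).
by rewrite scaler0 addr0.
Qed.

Lemma tensor02_suml m (f : 'I_m -> Cinf) (U : 'I_m -> Vect) V :
  w (\sum_i f i *: U i) V = \sum_i f i * w (U i) V.
Proof.
elim/big_rec2: _ => [|i a b _ ab]; first exact: tensor02_0l.
by rewrite w_tensor.1 ab.
Qed.

Lemma tensor02_sumr m (f : 'I_m -> Cinf) U (V : 'I_m -> Vect) :
  w U (\sum_i f i *: V i) = \sum_i f i * w U (V i).
Proof.
elim/big_rec2: _ => [|i a b _ ab]; first exact: tensor02_0r.
by rewrite w_tensor.2 ab.
Qed.

Lemma tensor02Dl U U' V : w (U + U') V = w U V + w U' V.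
Proof. by rewrite -[U]scale1r w_tensor.1 mul1r scale1r. Qed.

Lemma tensor02Zl f U V : w (f *: U) V = f * w U V.
Proof. by rewrite -[f *: U]addr0 w_tensor.1 tensor02_0l addr0. Qed.

Lemma tensor02Bl U U' V : w (U - U') V = w U V - w U' V.
Proof. by rewrite tensor02Dl -scaleN1r tensor02Zl mulN1r. Qed.

Lemma symmetrized_tensor02 : tensor02 (symmetrized w).
Proof.
split=> *; rewrite /symmetrized w_tensor.1 w_tensor.2; ring.
Qed.

End Forms.

Section Connections.
Context {nabla : Vect -> Vect -> Vect} (nabla_linear : linear_connection nabla).

Lemma connection0l V : nabla 0 V = 0.
Proof.
have [nablaL _ _] := nabla_linear.
apply: (addIr (nabla 0 V)); rewrite add0r -[X in X + _]scale1r -nablaL.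
by rewrite scaler0 addr0.
Qed.

Lemma connectionZDl f U U' V : nabla (f *: U + U') V = f *: nabla U V + nabla U' V.
Proof. by have [] := nabla_linear. Qed.

Lemma connectionDl U U' V : nabla (U + U') V = nabla U V + nabla U' V.
Proof. by rewrite -[U]scale1r connectionZDl !scale1r. Qed.

Lemma connectionZl f U V : nabla (f *: U) V = f *: nabla U V.
Proof. by rewrite -[f *: U]addr0 connectionZDl connection0l addr0. Qed.

Lemma connectionNl U V : nabla (- U) V = - nabla U V.
Proof. by rewrite -scaleN1r connectionZl scaleN1r. Qed.

Lemma connectionDr U V V' : nabla U (V + V') = nabla U V + nabla U V'.
Proof. by have [] := nabla_linear. Qed.

Lemma connectionZr U f V :
  nabla U (f *: V) = (U f : Cinf) *: V + f *: nabla U V.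
Proof. by have [] := nabla_linear. Qed.

Lemma connection0r U : nabla U 0 = 0.
Proof. by apply: (addIr (nabla U 0)); rewrite -connectionDr !add0r. Qed.

Lemma connection_suml m (f : 'I_m -> Cinf) (U : 'I_m -> Vect) V :
  nabla (\sum_i f i *: U i) V = \sum_i f i *: nabla (U i) V.
Proof.
elim/big_rec2: _ => [|i a b _ ab]; first exact: connection0l.
by rewrite connectionZDl ab.
Qed.

(** The coefficients have to be constant: by the Leibniz rule other functions
would contribute their derivatives. *)
Lemma connection_sumr_cst m (x : 'I_m -> R) U (V : 'I_m -> Vect) :
  nabla U (\sum_i smooth_cst M (x i) *: V i) =
  \sum_i smooth_cst M (x i) *: nabla U (V i).
Proof.
elim/big_rec2: _ => [|i a b _ <-]; first exact: connection0r.
by rewrite connectionDr connectionZr vfield_cst scale0r add0r.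
Qed.

Lemma lie_bracketZDl f (U U' V : Vect) :
  lie_bracket (f *: U + U') V =
  f *: lie_bracket U V - (V f : Cinf) *: U + lie_bracket U' V.
Proof.
apply/val_inj/funext => h.
change (f * U (V h) + U' (V h) - V (f * U h + U' h) =
  f * (U (V h) - V (U h)) - V f * U h + (U' (V h) - V (U' h)) :> Cinf).
rewrite vfieldD vfieldM.
move: (U (V h)) (U' (V h)) (V (U h)) (V f) (U h) (V (U' h)) => a b c d k l.
rewrite /GRing.regular in a b c d k l *; ring.
Qed.

Lemma lie_bracketC (U V : Vect) : lie_bracket V U = - lie_bracket U V.
Proof.
apply/val_inj/funext => h.
by change (V (U h) - U (V h) = - (U (V h) - V (U h)) :> Cinf); rewrite opprB.
Qed.

Lemma lie_bracketxx (U : Vect) : lie_bracket U U = 0.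
Proof. by apply: vfield_ext => h; rewrite [LHS]subrr. Qed.

(** The derivative of [f] arising from [nabla V (f *: nabla U W)] cancels the one
arising from the bracket of [f *: U] and [V]. *)
Lemma curvatureZDl f U U' V W :
  curvature nabla (f *: U + U') V W =
  f *: curvature nabla U V W + curvature nabla U' V W.
Proof.
rewrite /curvature lie_bracketZDl !(connectionDl, connectionZl, connectionNl).
rewrite connectionDr connectionZr.
by apply: vfield_ext => h; rewrite !vfieldE; ring.
Qed.

Lemma lie_bracketE (U V : Vect) f :
  (lie_bracket U V f : Cinf) = (U (V f) : Cinf) - (V (U f) : Cinf).
Proof. by []. Qed.

(** The second derivatives of [f] form the action of the bracket on [f], which
the last term of the curvature removes; the first derivatives cancel by
symmetry in [U] and [V]. *)
Lemma curvatureZDr f U V W W' :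
  curvature nabla U V (f *: W + W') =
  f *: curvature nabla U V W + curvature nabla U V W'.
Proof.
rewrite /curvature !(connectionDr, connectionZr) lie_bracketE.
by apply: vfield_ext => h; rewrite !vfieldE; ring.
Qed.

End Connections.

Lemma ricci_tensor02 (g : Vect -> Vect -> Cinf) (nabla : Vect -> Vect -> Vect)
    (e1 e2 e3 : Vect) :
  tensor02 g -> linear_connection nabla -> tensor02 (ricci g nabla e1 e2 e3).
Proof.
move=> g_tensor nabla_linear; split=> *.
  by rewrite /ricci !(curvatureZDl nabla_linear) !g_tensor.1; ring.
by rewrite /ricci !(curvatureZDr nabla_linear) !g_tensor.1; ring.
Qed.

(** The Koszul formula. Expand the derivatives of the metric by compatibility
and the brackets by the absence of torsion: by symmetry of [g] all the terms but
two copies of [g (nabla U V) W] cancel. *)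
Lemma levi_civita_koszul (g : Vect -> Vect -> Cinf)
    (nabla : Vect -> Vect -> Vect) (U V W : Vect) :
  tensor02 g -> (forall U V, g U V = g V U) -> levi_civita g nabla ->
  2%:R * g (nabla U V) W =
  (U (g V W) : Cinf) + (V (g W U) : Cinf) - (W (g U V) : Cinf)
  + g (lie_bracket U V) W - g (lie_bracket V W) U + g (lie_bracket W U) V.
Proof.
move=> g_tensor g_sym [_ torsion_free metric].
rewrite !metric -!torsion_free !(tensor02Bl g_tensor).
rewrite (g_sym V (nabla U W)) (g_sym W (nabla V U)) (g_sym U (nabla W V)).
ring.
Qed.

End Tensors.

(** * Frames with constant structure coefficients *)

Section ConstantFrame.
Context {R : realType} {n : nat} {M : manifoldType R n} {m : nat}.
Context (e : 'I_m -> vfield M).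
Local Notation Cinf := (smoothFun M).
Local Notation Vect := (vfield M).
Local Notation cst := (smooth_cst M).

Definition frame_vec (x : 'I_m -> R) : Vect := \sum_i cst (x i) *: e i.

Lemma eq_frame_vec x y : x =1 y -> frame_vec x = frame_vec y.
Proof. by move=> xy; apply: eq_bigr => i _; rewrite xy. Qed.

Lemma frame_vecB x y : frame_vec x - frame_vec y = frame_vec (fun i => x i - y i).
Proof.
by rewrite /frame_vec -sumrB; apply: eq_bigr => i _; rewrite rmorphB scalerBl.
Qed.

Lemma frame_vec_sum (x : 'I_m -> R) (y : 'I_m -> 'I_m -> R) :
  \sum_i cst (x i) *: frame_vec (y i) = frame_vec (fun k => \sum_i x i * y i k).
Proof.
rewrite /frame_vec; under eq_bigr do rewrite scaler_sumr.
rewrite exchange_big; apply: eq_bigr => k _ /=.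
rewrite rmorph_sum scaler_suml; apply: eq_bigr => i _.
by rewrite rmorphM scalerA.
Qed.

(** This is applied to connections and also to [lie_bracket], for which the
coefficients are the structure constants. *)
Definition frame_connection (nabla : Vect -> Vect -> Vect)
    (G : 'I_m -> 'I_m -> 'I_m -> R) : Prop :=
  forall i j, nabla (e i) (e j) = frame_vec (G i j).

Definition frame_form (w : Vect -> Vect -> Cinf) (s : 'I_m -> 'I_m -> R) : Prop :=
  forall i j, w (e i) (e j) = cst (s i j).

Lemma frame_form_vecl w s x j : tensor02 w -> frame_form w s ->
  w (frame_vec x) (e j) = cst (\sum_i x i * s i j).
Proof.
move=> w_tensor ws; rewrite (tensor02_suml w_tensor) rmorph_sum.
by apply: eq_bigr => i _; rewrite ws rmorphM.
Qed.

Lemma frame_form_vecr w s i x : tensor02 w -> frame_form w s ->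
  w (e i) (frame_vec x) = cst (\sum_j x j * s i j).
Proof.
move=> w_tensor ws; rewrite (tensor02_sumr w_tensor) rmorph_sum.
by apply: eq_bigr => j _; rewrite ws rmorphM.
Qed.

Lemma frame_orthogonal g eta x j : tensor02 g ->
  frame_form g (fun i j => if i == j then eta i else 0) ->
  g (frame_vec x) (e j) = cst (x j * eta j).
Proof.
move=> g_tensor g_e; rewrite (frame_form_vecl _ _ g_tensor g_e) (bigD1 j) //= eqxx.
by rewrite big1 ?addr0 // => i /negPf ->; rewrite mulr0.
Qed.

(** The two quadratic sums come from the iterated covariant derivatives, the last
one from the derivative along the bracket; [l] indexes the component. *)
Definition curvature_coef (c G : 'I_m -> 'I_m -> 'I_m -> R) i j k l : R :=
  \sum_p (G j k p * G i p l) - \sum_p (G i k p * G j p l)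
  - \sum_p (c i j p * G p k l).

Lemma frame_curvature nabla c G i j k :
  linear_connection nabla -> frame_connection lie_bracket c ->
  frame_connection nabla G ->
  curvature nabla (e i) (e j) (e k) = frame_vec (curvature_coef c G i j k).
Proof.
move=> nabla_linear ec eG; rewrite /curvature ec !eG.
rewrite !(connection_sumr_cst nabla_linear) (connection_suml nabla_linear).
under eq_bigr do rewrite eG.
under [X in _ - X - _]eq_bigr do rewrite eG.
under [X in _ - _ - X]eq_bigr do rewrite eG.
by rewrite !frame_vec_sum !frame_vecB.
Qed.

(** The term differentiating the component of [w] vanishes, this component being
a constant. *)
Lemma frame_covariant_derivative nabla w G s i j k :
  tensor02 w -> frame_form w s -> frame_connection nabla G ->
  covariant_derivative nabla w (e i) (e j) (e k) =
  cst (- \sum_l G i j l * s l k - \sum_l G i k l * s j l).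
Proof.
move=> w_tensor ws eG; rewrite /covariant_derivative ws vfield_cst !eG sub0r.
rewrite (frame_form_vecl _ _ w_tensor ws) (frame_form_vecr _ _ w_tensor ws).
by rewrite rmorphB rmorphN.
Qed.

Lemma frame_symmetrized w s : frame_form w s ->
  frame_form (symmetrized w) (fun i j => 2^-1 * (s i j + s j i)).
Proof. by move=> ws i j; rewrite /symmetrized !ws -rmorphD -rmorphM. Qed.

(** The derivatives in the Koszul formula vanish, the metric having constant
components. *)
Lemma frame_koszul g nabla eta c i j k :
  tensor02 g -> (forall U V, g U V = g V U) -> levi_civita g nabla ->
  frame_form g (fun i j => if i == j then eta i else 0) ->
  frame_connection lie_bracket c ->
  g (nabla (e i) (e j)) (e k) =
  cst (2^-1 * (c i j k * eta k - c j k i * eta i + c k i j * eta j)).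
Proof.
move=> g_tensor g_sym nabla_lc g_e ec.
have half : cst 2^-1 * (2%:R * g (nabla (e i) (e j)) (e k)) =
            g (nabla (e i) (e j)) (e k).
  by rewrite mulrA -(rmorph_nat cst 2) -rmorphM mulVf ?pnatr_eq0 // rmorph1 mul1r.
rewrite -half (levi_civita_koszul _ _ _ g_tensor g_sym nabla_lc).
rewrite !g_e !vfield_cst !ec !(frame_orthogonal _ _ g_tensor g_e).
by rewrite !addr0 subr0 add0r -rmorphB -rmorphD -rmorphM.
Qed.

Lemma frame_codazzi (p : M) nabla w G s i j k :
  tensor02 w -> frame_form w s -> frame_connection nabla G ->
  codazzi nabla w ->
  \sum_l G i j l * s l k + \sum_l G i k l * s j l =
  \sum_l G j i l * s l k + \sum_l G j k l * s i l.
Proof.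
move=> w_tensor ws eG /(_ (e i) (e j) (e k)).
rewrite !(frame_covariant_derivative _ _ _ w_tensor ws eG) -rmorphB.
rewrite -(rmorph0 (smooth_cst M)) => /(smooth_cst_inj p) /subr0_eq.
by rewrite -!opprD => /oppr_inj.
Qed.

End ConstantFrame.

(** * The Bott connection of a pseudo-orthonormal frame *)

Section SplitFrame.
Context {R : realType} {n : nat} {M : manifoldType R n}.
Local Notation Cinf := (smoothFun M).
Local Notation Vect := (vfield M).
Local Notation cst := (smooth_cst M).
Context {e1 e2 e3 : Vect}.
Local Notation e := (fun i : 'I_3 => [:: e1; e2; e3]`_i).

Definition signature3 (i : 'I_3) : R := if (i < 2)%N then 1 else -1.

Definition lorentz_form (i j : 'I_3) : R := if i == j then signature3 i else 0.

(** The parenthesis and the factor [2^-1] are the inner product with [e k] given by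
the Koszul formula; as [e k] may be timelike, its sign turns this inner product
into a component. *)
Definition levi_civita_coef (c : 'I_3 -> 'I_3 -> 'I_3 -> R) (i j k : 'I_3) : R :=
  signature3 k * (2^-1 * (c i j k * signature3 k - c j k i * signature3 i
                          + c k i j * signature3 j)).

Definition same_summand (i j : 'I_3) : bool := (i < 2)%N == (j < 2)%N.

(** Both the projection of the Levi-Civita connection (when [e i] and [e j] lie
in the same distribution) and that of the bracket (when they do not) land in the
distribution containing [e j]. *)
Definition bott_coef (c : 'I_3 -> 'I_3 -> 'I_3 -> R) (i j k : 'I_3) : R :=
  if same_summand j k then
    if same_summand i j then levi_civita_coef c i j k else c i j k
  else 0.

Lemma span_sections_frame (i : 'I_3) :
  if (i < 2)%N then span_sections [:: e1; e2] (e i) else span_sections [:: e3] (e i).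
Proof.
case: i => -[|[|[|//]]] ? /=.
- exists (fun i => if i == ord0 then 1 else 0).
  by rewrite !big_ord_recl big_ord0 /= scale1r scale0r !addr0.
- exists (fun i => if i == ord0 then 0 else 1).
  by rewrite !big_ord_recl big_ord0 /= scale1r scale0r !addr0 add0r.
- by exists (fun=> 1); rewrite big_ord_recl big_ord0 /= scale1r addr0.
Qed.

(** The sign of [g e3 e3] compensates for the sign of the last term in the
definition of the Ricci tensor, so that up to sign it is a plain trace. *)
Lemma ricci_frame g nabla c G :
  tensor02 g -> frame_form e g lorentz_form -> linear_connection nabla ->
  frame_connection e lie_bracket c -> frame_connection e nabla G ->
  frame_form e (ricci g nabla e1 e2 e3)
    (fun i j => - \sum_k curvature_coef c G i k j k).
Proof.
move=> g_tensor g_e nabla_linear ec eG i j.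
have g_curv k : g (curvature nabla (e i) (e k) (e j)) (e k) =
    cst (curvature_coef c G i k j k * signature3 k).
  rewrite (frame_curvature _ _ _ nabla_linear ec eG).
  by rewrite (frame_orthogonal _ _ g_tensor g_e).
have := (g_curv ord0, g_curv (lift ord0 ord0), g_curv (lift ord0 (lift ord0 ord0))).
rewrite /ricci /= => -[[-> ->] ->].
rewrite -!rmorphN -!rmorphD !big_ord_recl big_ord0 /signature3 /=.
by congr cst; ring.
Qed.

(** The splitting of [U] shows that it is a combination of the frame, whose
coefficients are recovered by pairing with the frame vectors; the projections
drop part of them. *)
Lemma projections_frame g pi pi' U y :
  projections (span_sections [:: e1; e2]) (span_sections [:: e3]) pi pi' ->
  tensor02 g -> frame_form e g lorentz_form ->
  (forall i : 'I_3, g U (e i) = cst (y i)) ->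
  pi U = frame_vec e (fun k => if (k < 2)%N then signature3 k * y k else 0) /\
  pi' U = frame_vec e (fun k => if (k < 2)%N then 0 else signature3 k * y k).
Proof.
move=> pi_pi' g_tensor g_e gU; have [[a piU] [b pi'U] U_split] := pi_pi' U.
pose f (i : 'I_3) := [:: a ord0; a (lift ord0 ord0); b ord0]`_i.
have fU : U = \sum_i f i *: e i.
  by rewrite {1}U_split piU pi'U !big_ord_recl !big_ord0 /= !addr0 addrA.
have f_y k : f k = cst (signature3 k * y k).
  rewrite rmorphM /= -gU fU (tensor02_suml g_tensor) (bigD1 k) //= g_e /lorentz_form.
  rewrite eqxx big1 => [|i /negPf ik].
    rewrite addr0 mulrC -mulrA -rmorphM /signature3.
    by case: ifP => _; rewrite ?mulrNN mulr1 rmorph1 mulr1.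
  by rewrite g_e /lorentz_form ik rmorph0 mulr0.
rewrite piU pi'U /frame_vec !big_ord_recl !big_ord0 /= !rmorph0 !scale0r.
by rewrite !addr0 !add0r -!f_y.
Qed.

(** The four clauses defining the Bott connection, according to the distributions
containing [e i] and [e j], match the cases of [bott_coef]: the Koszul formula or
the structure constants give the inner products with the frame, from which
[projections_frame] computes the projection. *)
Lemma bott_frame g nablaL nabla pi pi' c :
  tensor02 g -> (forall U V, g U V = g V U) -> frame_form e g lorentz_form ->
  levi_civita g nablaL ->
  projections (span_sections [:: e1; e2]) (span_sections [:: e3]) pi pi' ->
  bott_connection (span_sections [:: e1; e2]) (span_sections [:: e3])
    pi pi' nablaL nabla ->
  frame_connection e lie_bracket c ->
  frame_connection e nabla (bott_coef c).
Proof.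
move=> g_tensor g_sym g_e nablaL_lc pi_pi' [_ bDD bD'D bDD' bD'D'] ec i j.
have [Di Dj] := (span_sections_frame i, span_sections_frame j).
have lieE (k : 'I_3) :
    g (lie_bracket (e i) (e j)) (e k) = cst (c i j k * signature3 k).
  by rewrite ec (frame_orthogonal _ _ g_tensor g_e).
have lcE k := frame_koszul i j k g_tensor g_sym nablaL_lc g_e ec.
have [pi_lie pi'_lie] := projections_frame pi_pi' g_tensor g_e lieE.
have [pi_lc pi'_lc] := projections_frame pi_pi' g_tensor g_e lcE.
have sig2 (k : 'I_3) x : signature3 k * (x * signature3 k) = x.
  by rewrite /signature3; case: ifP => _; ring.
case: ifP Di => i2 Di; case: ifP Dj => j2 Dj.
- rewrite bDD // pi_lc; apply: eq_frame_vec => k.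
  by rewrite /bott_coef /same_summand i2 j2; case: ifP.
- rewrite bDD' // pi'_lie; apply: eq_frame_vec => k.
  by rewrite /bott_coef /same_summand i2 j2; case: ifP => //= _; rewrite sig2.
- rewrite bD'D // pi_lie; apply: eq_frame_vec => k.
  by rewrite /bott_coef /same_summand i2 j2; case: ifP => //= _; rewrite sig2.
- rewrite bD'D' // pi'_lc; apply: eq_frame_vec => k.
  by rewrite /bott_coef /same_summand i2 j2; case: ifP.
Qed.

End SplitFrame.

(** * The algebra G7 *)

Section G7.
Context {R : realType} (alpha beta gamma delta : R).

(** Coefficients listed by [i], then [j], then the component [k]. *)
Definition table3 (t : seq (seq (seq R))) (i j k : 'I_3) : R :=
  (nth [::] (nth [::] t i) j)`_k.

Definition g7_bracket := table3
  [:: [:: [:: 0; 0; 0]; [:: - alpha; - beta; - beta]; [:: alpha; beta; beta]];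
      [:: [:: alpha; beta; beta]; [:: 0; 0; 0]; [:: gamma; delta; delta]];
      [:: [:: - alpha; - beta; - beta]; [:: - gamma; - delta; - delta];
          [:: 0; 0; 0]]].

Definition g7_bott := table3
  [:: [:: [:: 0; alpha; 0]; [:: - alpha; 0; 0]; [:: 0; 0; beta]];
      [:: [:: 0; beta; 0]; [:: - beta; 0; 0]; [:: 0; 0; delta]];
      [:: [:: - alpha; - beta; 0]; [:: - gamma; - delta; 0]; [:: 0; 0; 0]]].

Definition g7_ricci (i j : 'I_3) : R :=
  (nth [::]
    [:: [:: - alpha ^+ 2; beta * delta; beta * (alpha + delta)];
        [:: - alpha * beta; - alpha ^+ 2 - beta ^+ 2 - beta * gamma;
            beta * gamma + delta ^+ 2];
        [:: beta * (alpha + delta); delta * (alpha + delta); 0]]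
    i)`_j.

Lemma g7_bott_coef i j k : bott_coef g7_bracket i j k = g7_bott i j k.
Proof.
case: i j k => -[|[|[|//]]] ? [[|[|[|//]]] ?] [[|[|[|//]]] ?].
all: rewrite /bott_coef /levi_civita_coef /signature3 /g7_bott /g7_bracket /table3 /=.
all: by field; rewrite ?pnatr_eq0.
Qed.

Lemma g7_ricci_coef i j :
  - \sum_k curvature_coef g7_bracket g7_bott i k j k = g7_ricci i j.
Proof.
case: i j => -[|[|[|//]]] ? [[|[|[|//]]] ?].
all: rewrite /curvature_coef !big_ord_recl !big_ord0.
all: rewrite /g7_ricci /g7_bott /g7_bracket /table3 /=.
all: ring.
Qed.

End G7.

Lemma g7_codazzi_alpha_delta {R : realType} (alpha beta gamma delta : R) :
  beta ^+ 2 * delta = 0 ->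
  4%:R * alpha ^+ 3 - alpha ^+ 2 * delta - 2%:R * alpha * delta ^+ 2
    - 4%:R * beta ^+ 2 * delta = 0 ->
  delta * (alpha * delta + 3%:R * beta * gamma + 2%:R * delta ^+ 2) = 0 ->
  alpha + delta = 0.
Proof.
have cancel3 (x : R) : x ^+ 3 = 0 -> x = 0.
  by move/eqP; rewrite expf_eq0 => /andP[_ /eqP].
move=> b2d e131 e233; have [d0|d_neq0] := eqVneq delta 0.
  rewrite d0 addr0; apply: cancel3; apply: (@mulfI _ 4%:R); first by rewrite pnatr_eq0.
  by rewrite mulr0 -e131 d0; ring.
have b0 : beta = 0.
  by move/eqP: b2d; rewrite mulf_eq0 (negPf d_neq0) orbF expf_eq0 => /andP[_ /eqP].
have a_d : alpha = - 2%:R * delta.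
  have: delta ^+ 2 * (alpha + 2%:R * delta) = 0 by rewrite -e233 b0; ring.
  move/eqP; rewrite mulf_eq0 expf_eq0 (negPf d_neq0) /= addr_eq0 => /eqP ->.
  by rewrite mulNr.
case/negP: d_neq0; apply/eqP/cancel3; apply: (@mulfI _ (- 32%:R)).
  by rewrite oppr_eq0 pnatr_eq0.
by rewrite mulr0 -e131 a_d b0; ring.
Qed.

Unset Implicit Arguments.
Set Strict Implicit.

Theorem theorem2p22 (R : realType) (alpha beta gamma delta : R)
  (alpha_delta_neq0 : alpha + delta != 0) (alpha_gamma_eq0 : alpha * gamma = 0)
  (G7 : lieGroupType R 3)
  (G7_connected : connected [set: G7])
  (G7_simply_connected : simply_connected R G7)
  (g : vfield G7 -> vfield G7 -> smoothFun G7)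
  (g_lorentzian : lorentzian_metric g)
  (g_left_invariant : left_invariant_metric g)
  (e1 e2 e3 : vfield G7)
  (e_basis : lie_algebra_basis [:: e1; e2; e3])
  (g_e11 : g e1 e1 = 1) (g_e22 : g e2 e2 = 1) (g_e33 : g e3 e3 = -1)
  (g_e12 : g e1 e2 = 0) (g_e13 : g e1 e3 = 0) (g_e23 : g e2 e3 = 0)
  (bracket_e12 : lie_bracket e1 e2 =
     smooth_cst G7 (- alpha) *: e1 + smooth_cst G7 (- beta) *: e2
     + smooth_cst G7 (- beta) *: e3)
  (bracket_e13 : lie_bracket e1 e3 =
     smooth_cst G7 alpha *: e1 + smooth_cst G7 beta *: e2
     + smooth_cst G7 beta *: e3)
  (bracket_e23 : lie_bracket e2 e3 =
     smooth_cst G7 gamma *: e1 + smooth_cst G7 delta *: e2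
     + smooth_cst G7 delta *: e3)
  (nablaL : vfield G7 -> vfield G7 -> vfield G7)
  (nablaL_levi_civita : levi_civita g nablaL)
  (piD piDperp : vfield G7 -> vfield G7)
  (piD_piDperp : projections (span_sections [:: e1; e2]) (span_sections [:: e3])
                   piD piDperp)
  (nablaB : vfield G7 -> vfield G7 -> vfield G7)
  (nablaB_bott : bott_connection (span_sections [:: e1; e2])
                   (span_sections [:: e3]) piD piDperp nablaL nablaB) :
  ~ codazzi nablaB (symmetrized (ricci g nablaB e1 e2 e3)).
Proof.
move=> ricci_codazzi.
have [g_tensor g_sym _] := g_lorentzian.
have [nablaB_linear _ _ _ _] := nablaB_bott.
pose e (i : 'I_3) := [:: e1; e2; e3]`_i.
have ec : frame_connection e lie_bracket (g7_bracket alpha beta gamma delta).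
  have row (i j k : R) : frame_vec e (fun p => [:: i; j; k]`_p) =
      smooth_cst G7 i *: e1 + smooth_cst G7 j *: e2 + smooth_cst G7 k *: e3.
    by rewrite /frame_vec !big_ord_recl big_ord0 addr0 addrA.
  have row0 : frame_vec e (fun p => [:: 0; 0; 0]`_p) = 0.
    by rewrite row rmorph0 !scale0r !addr0.
  case=> -[|[|[|//]]] ? [[|[|[|//]]] ?]; rewrite /e /= ?lie_bracketxx ?row0 //.
  - by rewrite [RHS]row.
  - by rewrite [RHS]row.
  - by rewrite lie_bracketC bracket_e12 [RHS]row !rmorphN !scaleNr !opprD !opprK.
  - by rewrite [RHS]row.
  - by rewrite lie_bracketC bracket_e13 [RHS]row !rmorphN !scaleNr !opprD.
  - by rewrite lie_bracketC bracket_e23 [RHS]row !rmorphN !scaleNr !opprD.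
have cst0 : smooth_cst G7 0 = 0 by exact: rmorph0.
have cst1 : smooth_cst G7 1 = 1 by exact: rmorph1.
have cstN1 : smooth_cst G7 (-1) = -1 by exact: rmorphN1.
have g_e : frame_form e g lorentz_form.
  case=> -[|[|[|//]]] ? [[|[|[|//]]] ?]; rewrite /e /lorentz_form /signature3 /=;
    by rewrite ?(g_sym e2 e1) ?(g_sym e3) ?cst0 ?cst1 ?cstN1.
have eB : frame_connection e nablaB (g7_bott alpha beta gamma delta).
  move=> i j; rewrite (bott_frame g_tensor g_sym g_e nablaL_levi_civita
    piD_piDperp nablaB_bott ec) //.
  by apply: eq_frame_vec => k; rewrite g7_bott_coef.
have e_ricci : frame_form e (ricci g nablaB e1 e2 e3)
    (g7_ricci alpha beta gamma delta).
  by move=> i j; rewrite (ricci_frame g_tensor g_e nablaB_linear ec eB) g7_ricci_coef.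
have sym_tensor := symmetrized_tensor02 (ricci_tensor02 e1 e2 e3 g_tensor nablaB_linear).
have cod i j k := frame_codazzi (1%g : G7) i j k sym_tensor (frame_symmetrized e_ricci)
  eB ricci_codazzi.
pose i1 : 'I_3 := @Ordinal 3 0 isT; pose i2 : 'I_3 := @Ordinal 3 1 isT.
pose i3 : 'I_3 := @Ordinal 3 2 isT.
(* The Codazzi equations contain multiples of [alpha * beta * gamma]. *)
have abc : alpha * beta * gamma = 0 by rewrite mulrAC alpha_gamma_eq0 mul0r.
move: (cod i1 i2 i1) (cod i1 i3 i1) (cod i2 i3 i3).
rewrite !big_ord_recl !big_ord0 /g7_bott /g7_ricci /table3 /=.
move=> cod121 cod131 cod233.
move/eqP: alpha_delta_neq0; apply.
by apply: (@g7_codazzi_alpha_delta R alpha beta gamma delta); lra.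
Qed.
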